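(* Let $k\ge1$, $c>0$ and $d>6+2\sqrt7$. There exists $\eta=\eta(d,c,k)>0$ such that for every $\varepsilon>0$ there exists $p_0=p_0(\varepsilon,d,c,k)\in(0,1)$ with the following property. If $G=(V,E)$ is a finite connected graph with all degrees at most $k$ satisfying the isoperimetric inequality $(\mathrm{ID}_{d,c})$, then for every $p\ge p_0$: (i) $\mathbb P_p(|K_v|\ge(1-\varepsilon)|V|)\ge 1-\varepsilon$ for every $v\in V$; and (ii) $\mathbb P_p(A\leftrightarrow B)\ge 1-\varepsilon\exp\bigl[-\eta\min\{|A|,|B|\}^{(d-2)/d}\bigr]$ for every two nonempty sets $A,B\subseteq V$.
   Context: A locally finite graph $G=(V,E)$ satisfies the $d$-dimensional isoperimetric inequality $(\mathrm{ID}_{d,c})$ if $|\partial_E K|\ge c\min\{|K|,|V\setminus K|\}^{(d-1)/d}$ for every finite $K\subseteq V$, where $\partial_E K$ is the set of edges with one endpoint in $K$ and one in $V\setminus K$. $\mathbb P_p$ is the law of Bernoulli-$p$ bond percolation (each edge open independently with probability $p$); $K_v$ is the open cluster of $v$; $\{A\leftrightarrow B\}$ is the event that some open path connects a vertex of $A$ to a vertex of $B$. *)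

(* Defs.v *)
From HB Require Import structures.
From mathcomp Require Import all_boot all_order all_algebra.
From mathcomp Require Import reals sequences exp.
Set Implicit Arguments. Unset Strict Implicit. Unset Printing Implicit Defensive.
Import Order.TTheory GRing.Theory Num.Theory.
Local Open Scope ring_scope.

(* A finite simple graph: vertex type V (finite), adjacency relation e
   (required symmetric and irreflexive in the theorem). *)

Section Graph.
Variables (V : finType) (e : rel V).

Definition edges : {set {set V}} :=
  [set [set x; y] | x in V, y in V & e x y].

Definition max_degree_le (k : nat) : Prop :=
  forall x : V, (#|[set y | e x y]| <= k)%N.

Definition connected_graph : Prop := forall x y : V, connect e x y.

(* |∂_E K| : edges with one endpoint in K and the other in V \ K
   (each such edge counted once, via its orientation from K to V \ K) *)
Definition edge_boundary (K : {set V}) : nat :=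
  #|[set xy : V * V | [&& xy.1 \in K, xy.2 \notin K & e xy.1 xy.2]]|.

(* configurations: sets of open edges *)
Definition open_rel (w : {set {set V}}) : rel V :=
  fun x y => e x y && ([set x; y] \in w).

Definition cluster (w : {set {set V}}) (v : V) : {set V} :=
  [set u | connect (open_rel w) v u].

Definition joined (w : {set {set V}}) (A B : {set V}) : bool :=
  [exists a in A, exists b in B, connect (open_rel w) a b].

Variable R : realType.

Definition perc_prob (p : R) (ev : pred {set {set V}}) : R :=
  \sum_(w : {set {set V}} | (w \subset edges) && ev w)
     p ^+ #|w| * (1 - p) ^+ #|edges :\: w|.

Definition isoperimetric (d c : R) : Prop :=
  forall K : {set V},
    (edge_boundary K)%:R >=
      c * powR (minn #|K| #|~: K|)%:R ((d - 1) / d).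

End Graph.

(* Main.v *)
Require Import Defs.
From HB Require Import structures.
From mathcomp Require Import all_boot all_order all_algebra.
From mathcomp Require Import reals sequences exp.
From mathcomp Require Import lra ring zify.
Import Order.TTheory GRing.Theory Num.Theory.
Set Implicit Arguments. Unset Strict Implicit. Unset Printing Implicit Defensive.
Local Open Scope ring_scope.

(** A Peierls argument, in which the cuts separating [A] from [B] are counted by
    random contraction as in Karger's algorithm. Start from the partition of [V]
    into singletons; repeatedly take the smallest class [S] that avoids [A] and
    [B] and contains at most half of the vertices, and merge it with a neighbour
    along a uniformly random edge of its boundary. Let [K] be a minimal cut. If
    [x] of the [b] boundary edges of [S] are cut by [K], then [x < b], and [K]
    survives the step with probability [1 - x/b >= exp (- 4 x / sqrt b)], where
    [b >= c |S|^((d-1)/d)]. Each step at least doubles the size of the class of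
    its vertices, or makes that class meet [A] or [B], so an edge of the cut is
    charged a geometric series: [K] survives to the end with probability at least
    [exp (- C |dK|)]. The final partition determines [K] up to the side of one
    large class, hence [sum_K exp (- C |dK|) <= 2], and the union bound over
    closed cuts applies as soon as [1 - p] is small compared to [exp (- C)].
    Part (i) follows from the case of singletons by Markov's inequality. *)

(** * Contraction of partitions and the weighted count of cuts *)

Section Contraction.
Variables (V : finType) (e : rel V).

Definition crosses (K : {set V}) (x y : V) : bool :=
  e x y && ((x \in K) != (y \in K)).

Definition crossing_degree (K : {set V}) (x : V) : nat :=
  #|[set y | crosses K x y]|.

Definition out_edges (S : {set V}) : {set V * V} :=
  [set xy : V * V | [&& xy.1 \in S, xy.2 \notin S & e xy.1 xy.2]].

(** A partition is encoded as the fibres of [f]; the cut [K] survives in it when no fibre is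
    split. *)
Definition compatible (f : V -> V) (K : {set V}) : bool :=
  [forall x, forall y, (f x == f y) ==> ((x \in K) == (y \in K))].

Definition class_of (f : V -> V) (x : V) : {set V} := [set y | f y == f x].

Definition merge (f : V -> V) (u v : V) : V -> V :=
  fun z => if f z == f u then f v else f z.

Variables (A B : {set V}).

(* For [S] homogeneous, the last clause says that [S] is not a union of
   components of the graph cut along the boundary of [K]. *)
Definition admissible (K : {set V}) : bool :=
  [&& A \subset K, [disjoint B & K] &
    [forall S : {set V}, [&& S != set0, [disjoint S & A :|: B] &
        (S \subset K) || [disjoint S & K]] ==>
      [exists xy in out_edges S, ~~ crosses K xy.1 xy.2]]].

Variables (R : realType) (g : nat -> R).

(** A class meeting [A] or [B] is never again the one selected for contraction, so its vertices have
    nothing left to pay. *)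
Definition class_weight (f : V -> V) (x : V) : R :=
  if [disjoint class_of f x & A :|: B] then g #|class_of f x| else 0.

(** Potential that bounds minus the logarithm of the probability that [K] survives the remaining
    contractions. *)
Definition energy (f : V -> V) (K : {set V}) : R :=
  \sum_x class_weight f x *+ crossing_degree K x.

Lemma compatibleP f (K : {set V}) :
  reflect (forall x y, f x = f y -> (x \in K) = (y \in K)) (compatible f K).
Proof.
apply: (iffP forallP) => [H x y fxy|H x].
  by have /forallP/(_ y)/implyP := H x; rewrite fxy eqxx => /(_ isT)/eqP.
by apply/forallP => y; apply/implyP => /eqP /H ->.
Qed.

Lemma class_of_merge f u v z :
  class_of (merge f u v) z =
  if (f z == f u) || (f z == f v) then class_of f u :|: class_of f v
  else class_of f z.
Proof.
apply/setP => y; rewrite !inE /merge.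
case: (eqVneq (f z) (f u)) => [zu|zu] /=.
  rewrite !inE; case: (eqVneq (f y) (f u)) => //= _; exact: eqxx.
case: (eqVneq (f z) (f v)) => [zv|zv] /=.
  by rewrite !inE zv; case: (eqVneq (f y) (f u)) => //= _; exact: eqxx.
rewrite !inE; case: (eqVneq (f y) (f u)) => //= ->.
by rewrite eq_sym (negbTE zv) eq_sym (negbTE zu).
Qed.

Lemma compatible_merge f u v K :
  compatible f K -> (u \in K) = (v \in K) -> compatible (merge f u v) K.
Proof.
move/compatibleP => H uv; apply/compatibleP => x y; rewrite /merge.
case: (eqVneq (f x) (f u)) => [/H ->|_]; case: (eqVneq (f y) (f u)) => [/H ->|_] //.
- by rewrite uv => /H.
- by rewrite uv => /H.
- exact: H.
Qed.

Lemma card_image_merge f u v : f u != f v ->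
  (#|merge f u v @: V| < #|f @: V|)%N.
Proof.
move=> uv; apply: proper_card; apply/properP; split.
  apply/subsetP => _ /imsetP[x _ ->]; rewrite /merge.
  by case: ifP => _; apply: imset_f.
exists (f u); first exact: imset_f.
apply/imsetP => -[x _]; rewrite /merge; case: ifP => [_ /eqP|fx].
  by rewrite (negbTE uv).
by move=> fux; rewrite fux eqxx in fx.
Qed.

Lemma card_class_ofU f u v : f u != f v ->
  #|class_of f u :|: class_of f v| = (#|class_of f u| + #|class_of f v|)%N.
Proof.
move=> uv; rewrite cardsU -[RHS]subn0; congr subn.
apply/eqP; rewrite cards_eq0; apply/eqP/setP => x; rewrite !inE.
by apply/negP => /andP[/eqP -> ]; rewrite (negbTE uv).
Qed.

Lemma class_of_self f x : x \in class_of f x.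
Proof. by rewrite inE. Qed.

Lemma card_class_gt0 f x : (0 < #|class_of f x|)%N.
Proof. by apply/card_gt0P; exists x; apply: class_of_self. Qed.

Definition eligible f x :=
  [disjoint class_of f x & A :|: B] && (2 * #|class_of f x| <= #|V|)%N.

(** Classes meeting [A] lie in [K] and those meeting [B] lie outside it. Any other class has more
    than half of the vertices, so there is at most one, and only its side is free. *)
Lemma card_compatible_le2 f : (forall x, ~~ eligible f x) ->
  (#|[set K | admissible K && compatible f K]| <= 2)%N.
Proof.
move=> Nelig.
have key K1 K2 :
    admissible K1 && compatible f K1 -> admissible K2 && compatible f K2 ->
    (forall x, [disjoint class_of f x & A :|: B] -> (x \in K1) = (x \in K2)) ->
    K1 = K2.
  move=> /andP[/and3P[AK1 BK1 _] /compatibleP C1].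
  move=> /andP[/and3P[AK2 BK2 _] /compatibleP C2] K12.
  apply/setP => x.
  have [/K12 //|/pred0Pn[y /= /andP[]]] := boolP [disjoint class_of f x & A :|: B].
  rewrite !inE => /eqP fyx /orP[yA|yB].
    by rewrite -(C1 _ _ fyx) -(C2 _ _ fyx) (subsetP AK1) // (subsetP AK2).
  by rewrite -(C1 _ _ fyx) -(C2 _ _ fyx) (disjointFr BK1) // (disjointFr BK2).
have [z djz|Nz] := pickP (fun z => [disjoint class_of f z & A :|: B]); last first.
  apply: (@leq_trans 1) => //; apply/card_le1_eqP => K1 K2; rewrite !inE => a1 a2.
  by apply: key => // x; rewrite Nz.
have Hz x : [disjoint class_of f x & A :|: B] -> f x = f z.
  move=> djx; have := Nelig x; have := Nelig z.
  rewrite /eligible djx djz /= -!ltnNge => zb xb.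
  apply/eqP/negPn/negP => fxz.
  have : (#|class_of f x| + #|class_of f z| <= #|V|)%N.
    by rewrite -card_class_ofU // max_card.
  by move: zb xb; move: #|class_of f x| #|class_of f z| #|V| => a b N; lia.
have inj : {in [set K | admissible K && compatible f K] &,
    injective (fun K : {set V} => z \in K)}.
  move=> K1 K2; rewrite !inE => a1 a2 z12; apply: key => // x /Hz xz.
  move: a1 a2 => /andP[_ /compatibleP C1] /andP[_ /compatibleP C2].
  by rewrite (C1 _ _ xz) (C2 _ _ xz).
by rewrite -(card_in_imset inj) -card_bool max_card.
Qed.

Hypothesis g_ge0 : forall s, 0 <= g s.
Hypothesis g_nincr : forall s t, (0 < s <= t)%N -> g t <= g s.
(** When [n] boundary edges of [S] cross the cut, the drop of [g] under doubling pays for the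
    probability of choosing one of them. *)
Hypothesis g_cost : forall (S : {set V}) (n : nat),
  S != set0 -> (2 * #|S| <= #|V|)%N -> (n < edge_boundary e S)%N ->
  expR (- ((g #|S| - g (2 * #|S|)) *+ n)) <= 1 - n%:R / (edge_boundary e S)%:R.

Lemma energy_ge0 f K : 0 <= energy f K.
Proof.
apply: sumr_ge0 => x _; rewrite mulrn_wge0 // /class_weight.
by case: ifP => _.
Qed.

Lemma class_weight_merge f u v z : f u != f v ->
  class_weight (merge f u v) z <= class_weight f z.
Proof.
move=> uv; rewrite /class_weight class_of_merge.
have [/orP zuv|_] := boolP ((f z == f u) || (f z == f v)); last exact: lexx.
case: ifP => [dj|_]; last by case: ifP.
have sub : class_of f z \subset class_of f u :|: class_of f v.
  apply/subsetP => y; rewrite !inE => /eqP ->.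
  by case: zuv => ->; rewrite ?orbT.
by rewrite (disjointWl sub dj) g_nincr // card_class_gt0 subset_leq_card.
Qed.

(** If the merged class still avoids [A] and [B], then the class of [v] is at least as large as that
    of [u]: by minimality when eligible, otherwise because it exceeds half of [V]. So the size at
    least doubles. *)
Lemma class_weight_merge_class f u v z : f u != f v -> f z = f u ->
  (forall x, eligible f x -> (#|class_of f u| <= #|class_of f x|)%N) ->
  eligible f u ->
  class_weight (merge f u v) z <=
    class_weight f z - (g #|class_of f u| - g (2 * #|class_of f u|)).
Proof.
move=> uv zu umin elu; have /andP[dju szu] := elu.
have -> : class_weight f z = g #|class_of f u|.
  by rewrite /class_weight /class_of zu -/(class_of f u) dju.
rewrite subKr /class_weight class_of_merge zu eqxx /=.
case: ifP => [dj|_]; last exact: g_ge0.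
have djv : [disjoint class_of f v & A :|: B].
  by apply: disjointWl dj; apply: subsetUr.
apply: g_nincr; rewrite muln_gt0 card_class_gt0 /= card_class_ofU // mul2n -addnn leq_add2l.
have [elv|] := boolP (eligible f v); first exact: umin.
by move: szu; rewrite /eligible djv /= -ltnNge => szu szv; lia.
Qed.

(** No edge inside a class crosses a compatible cut, so every crossing edge at the class leaves
    it. *)
Lemma sum_crossing_degree f K u : compatible f K ->
  \sum_(z in class_of f u) crossing_degree K z =
  #|[set xy in out_edges (class_of f u) | crosses K xy.1 xy.2]|.
Proof.
move=> /compatibleP cK.
under eq_bigr => z _ do rewrite /crossing_degree -sum1_card.
rewrite pair_big_dep /= -sum1_card; apply: eq_bigl => -[x y] /=.
rewrite !inE /= /crosses; case: (eqVneq (f x) (f u)) => //= xu.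
case: (e x y); rewrite ?andbF //= ?andbT.
case: (eqVneq (f y) (f u)) => //= yu.
by rewrite (cK x y) ?eqxx // xu yu.
Qed.

Lemma energy_merge f u v K : f u != f v -> eligible f u -> compatible f K ->
  (forall x, eligible f x -> (#|class_of f u| <= #|class_of f x|)%N) ->
  energy (merge f u v) K <= energy f K -
    (g #|class_of f u| - g (2 * #|class_of f u|)) *+
    #|[set xy in out_edges (class_of f u) | crosses K xy.1 xy.2]|.
Proof.
move=> uv elu cK umin; rewrite -(sum_crossing_degree _ cK) -sumrMnr.
rewrite /energy [X in _ <= X - _](bigID (mem (class_of f u))) /=.
rewrite [X in X <= _](bigID (mem (class_of f u))) /= addrAC -sumrB lerD //.
  apply: ler_sum => z; rewrite inE => /eqP zu; rewrite -mulrnBl.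
  by apply: ler_wMn2r; apply: class_weight_merge_class.
by apply: ler_sum => z _; apply: ler_wMn2r; apply: class_weight_merge.
Qed.

(* Karger-style contraction: the smallest class avoiding [A] and [B] is merged
   along a uniformly chosen edge of its boundary; the left-hand side is
   bounded by its average after the merge. *)
Lemma sum_expR_energy f :
  \sum_(K | admissible K && compatible f K) expR (- energy f K) <= 2.
Proof.
(* Induction on the number of classes. *)
have [n] := ubnP #|f @: V|; elim: n f => // n IH f; rewrite ltnS => fn.
have [x0 elx0|Nel] := pickP (eligible f); last first.
  apply: (@le_trans _ _ (\sum_(K | admissible K && compatible f K) 1)).
    by apply: ler_sum => K _; rewrite -expR0 ler_expR oppr_le0 energy_ge0.
  rewrite sumr_const ler_nat.
  rewrite (leq_trans _ (@card_compatible_le2 f _)) // => [|x]; last by rewrite Nel.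
  by rewrite cardsE.
have [u elu umin] := arg_minnP (fun x => #|class_of f x|) elx0.
set S := class_of f u; set b := edge_boundary e S.
have [djS szS] := andP elu.
have S0 : S != set0 by apply/set0Pn; exists u; apply: class_of_self.
have bE : b = #|out_edges S| by [].
have step K : admissible K && compatible f K ->
    expR (- energy f K) <= b%:R^-1 *
      \sum_(xy in out_edges S | ~~ crosses K xy.1 xy.2)
         expR (- energy (merge f xy.1 xy.2) K).
  move=> /andP[adK cK].
  set Xs := [set xy in out_edges S | crosses K xy.1 xy.2].
  have hom : (S \subset K) || [disjoint S & K].
    have [uK|uK] := boolP (u \in K).
      apply/orP; left; apply/subsetP => y; rewrite inE => /eqP yu.
      by rewrite (compatibleP _ _ cK _ _ yu).
    apply/orP; right; rewrite disjoints_subset; apply/subsetP => y; rewrite !inE => /eqP yu.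
    by rewrite (compatibleP _ _ cK _ _ yu).
  (* Admissibility gives a boundary edge of [S] that does not cross [K], whence the strict bound
     [#|Xs| < b] required by [g_cost]. *)
  have /and3P[_ _ /forallP/(_ S)/implyP] := adK.
  rewrite S0 djS hom => /(_ isT)/existsP[xy0 /andP[xy0o xy0c]].
  have cardX : (#|Xs| + #|[set xy in out_edges S | ~~ crosses K xy.1 xy.2]| = b)%N.
    have := cardsID [set xy : V * V | crosses K xy.1 xy.2] (out_edges S).
    rewrite -bE => <-; apply: f_equal2; apply: eq_card => xy.
      by rewrite !inE.
    by rewrite !inE andbC.
  have Y0 : (0 < #|[set xy in out_edges S | ~~ crosses K xy.1 xy.2]|)%N.
    by apply/card_gt0P; exists xy0; rewrite inE xy0o.
  have b0 : (0 < b)%N by rewrite -cardX addn_gt0 Y0 orbT.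
  have Xb : (#|Xs| < b)%N by rewrite -cardX -[X in (X < _)%N]addn0 ltn_add2l.
  apply: (@le_trans _ _ (b%:R^-1 * \sum_(xy in out_edges S | ~~ crosses K xy.1 xy.2)
     expR (- (energy f K - (g #|S| - g (2 * #|S|)) *+ #|Xs|)))); last first.
    rewrite ler_wpM2l ?invr_ge0 //; apply: ler_sum => xy /andP[xyo _].
    rewrite ler_expR lerN2.
    move: xyo; rewrite !inE => /and3P[/eqP xu yu _].
    have uS : class_of f u = class_of f xy.1 by rewrite /class_of xu.
    rewrite /Xs /S uS; apply: energy_merge => //.
    - by rewrite xu eq_sym.
    - by rewrite /eligible -uS.
    - by move=> x ex; rewrite -uS; apply: umin.
  rewrite (eq_bigl (mem [set xy in out_edges S | ~~ crosses K xy.1 xy.2])); last first.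
    by move=> xy; rewrite !inE.
  rewrite sumr_const opprB expRD -[X in _ <= _ * X]mulr_natl.
  rewrite [X in _ <= X]mulrA [X in _ <= X]mulrA [X in X * _ * _]mulrC.
  rewrite ler_peMl ?expR_ge0 //.
  have -> : #|[set xy in out_edges S | ~~ crosses K xy.1 xy.2]|%:R / b%:R =
      1 - #|Xs|%:R / b%:R :> R.
    rewrite -[in LHS](addKn #|Xs| #|[set xy in out_edges S | ~~ crosses K xy.1 xy.2]|).
    by rewrite cardX natrB 1?ltnW // mulrBl divff // pnatr_eq0 -lt0n.
  have := g_cost S0 szS Xb; rewrite expRN => gc.
  apply: le_trans (ler_wpM2r (expR_ge0 _) gc).
  by rewrite mulVf // gt_eqF // expR_gt0.
apply: le_trans (ler_sum _ step) _.
rewrite -mulr_sumr (exchange_big_dep (mem (out_edges S))) /=; last by move=> K xy _ /andP[].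
(* For [b = 0] the bound is zero by the convention on the inverse of 0. *)
have [b0|b0] := posnP b.
  by rewrite b0 invr0 mul0r.
rewrite mulrC ler_pdivrMr ?ltr0n //.
apply: (@le_trans _ _ (\sum_(xy in out_edges S) 2)); last first.
  by rewrite sumr_const bE mulr_natr.
apply: ler_sum => xy xyo.
have := xyo; rewrite 3!inE => /and3P[/eqP xu yu exy].
apply: le_trans (IH (merge f xy.1 xy.2) _); last first.
  apply: leq_trans fn; apply: card_image_merge.
  by rewrite xu eq_sym.
(* The cuts surviving the chosen edge are among those compatible with the merged partition; the
   remaining terms are nonnegative. *)
rewrite [X in _ <= X](bigID (fun K =>
  [&& admissible K, compatible f K & ~~ crosses K xy.1 xy.2])) /=.
rewrite [X in X <= _](_ : _ = \sum_(K |
    (admissible K && compatible (merge f xy.1 xy.2) K) &&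
    [&& admissible K, compatible f K & ~~ crosses K xy.1 xy.2])
  expR (- energy (merge f xy.1 xy.2) K)).
  by rewrite lerDl sumr_ge0 // => K _; apply: expR_ge0.
apply: eq_bigl => K; rewrite xu eqxx yu exy /= -andbA.
case: (admissible K) => //=; case cK: (compatible f K); rewrite ?andbF //=.
rewrite /crosses exy /= negbK andbC.
by case: eqP => //= xyK; rewrite compatible_merge.
Qed.

Lemma sum_expR_crossing_degree :
  \sum_(K | admissible K) expR (- (g 1 *+ \sum_x crossing_degree K x)) <= 2.
Proof.
apply: le_trans (sum_expR_energy id).
rewrite [X in _ <= X](eq_bigl (fun K => admissible K)); last first.
  move=> K; rewrite [compatible _ _](_ : _ = true) ?andbT //.
  by apply/compatibleP => x y ->.
apply: ler_sum => K _; rewrite ler_expR lerN2 -sumrMnr.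
apply: ler_sum => x _; apply: ler_wMn2r; rewrite /class_weight.
by case: ifP => _; rewrite ?g_ge0 // g_nincr // card_class_gt0.
Qed.

End Contraction.

(** * Edge cuts, by endpoints and as sets of unordered edges *)

Lemma sum_crossing_degreeE (V : finType) (e : rel V) (K : {set V}) :
  symmetric e -> (\sum_x crossing_degree e K x = 2 * edge_boundary e K)%N.
Proof.
move=> esym.
have half (S : {set V}) : (forall x y, (x \in S) != (y \in S) = ((x \in K) != (y \in K))) ->
    (\sum_(x in S) crossing_degree e K x = edge_boundary e S)%N.
  move=> SK; under eq_bigr => z _ do rewrite /crossing_degree -sum1_card.
  rewrite pair_big_dep /= /edge_boundary -sum1_card; apply: eq_bigl => -[x y] /=.
  rewrite !inE /= /crosses -SK.
  by case: (x \in S) => //=; rewrite andbC; case: (y \in S).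
rewrite (bigID (mem K)) /= half //.
rewrite (eq_bigl (mem (~: K))) => [|x]; last by rewrite !inE.
rewrite half => [|x y]; last by rewrite !inE; case: (x \in K); case: (y \in K).
rewrite mul2n -addnn; congr addn; rewrite /edge_boundary.
have swapK : injective (fun xy : V * V => (xy.2, xy.1)).
  by move=> [x y] [x' y'] [-> ->].
rewrite -(card_imset _ swapK); apply: eq_card => -[x y]; apply/imsetP/idP.
  move=> [[x' y']]; rewrite !inE /= negbK => /and3P[? ? ?] [-> ->].
  by rewrite esym; apply/and3P.
rewrite inE /= => /and3P[? ? ?]; exists (y, x) => //.
by rewrite !inE /= negbK esym; apply/and3P.
Qed.

Definition cut_edges (V : finType) (e : rel V) (K : {set V}) : {set {set V}} :=
  [set [set xy.1; xy.2] | xy in out_edges e K].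

Lemma card_cut_edges (V : finType) (e : rel V) (K : {set V}) :
  #|cut_edges e K| = edge_boundary e K.
Proof.
rewrite /cut_edges card_in_imset // => -[x y] [x' y']; rewrite !inE /=.
move=> /and3P[xK yK _] /and3P[xK' yK' _] /setP E.
have := E x; have := E y; rewrite !inE !eqxx ?orbT /=.
move=> /esym/orP[/eqP yx'|/eqP <-]; first by rewrite yx' xK' in yK.
by move=> /esym/orP[/eqP <-//|/eqP xy]; rewrite -xy xK in yK.
Qed.

Lemma cut_edges_subset (V : finType) (e : rel V) (K : {set V}) :
  cut_edges e K \subset edges e.
Proof.
apply/subsetP => _ /imsetP[[x y] + ->]; rewrite inE /= => /and3P[_ _ exy].
by apply/imset2P; exists x y => //; rewrite inE.
Qed.

(** * Bernoulli percolation: closed sets, complements, union bound *)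

Lemma perc_prob_closed (V : finType) (e : rel V) (R : realType) (p : R)
    (D : {set {set V}}) : D \subset edges e ->
  perc_prob e p (fun w => [disjoint w & D]) = (1 - p) ^+ #|D|.
Proof.
move=> /subsetP DE; pose E := edges e.
(* [F] and [G] are the weights of an open and a closed [i]. Opening a non-edge or an element of [D]
   has weight 0, so expanding the product of [F i + G i] over all vertex sets leaves exactly the
   wanted configurations. *)
pose F (i : {set V}) : R := if i \in E :\: D then p else 0.
pose G (i : {set V}) : R := if i \in E then 1 - p else 1.
transitivity (\prod_(i : {set V}) (F i + G i)); last first.
  rewrite (bigID (mem D)) /= [X in _ * X]big1 ?mulr1 => [|i iD].
    rewrite (eq_bigr (fun=> 1 - p)) ?prodr_const // => i iD.
    by rewrite /F /G inE iD /= DE // add0r.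
  by rewrite /F /G inE iD /=; case: ifP => _; rewrite ?add0r // addrC subrK.
transitivity (\sum_(w : {set {set V}}) \prod_i (if i \in w then F i else G i)); last first.
  by rewrite bigA_distr; apply: eq_bigl => w; rewrite inE.
rewrite /perc_prob [RHS](bigID (fun w : {set {set V}} =>
  (w \subset edges e) && [disjoint w & D])) /=.
rewrite [X in _ = _ + X]big1 ?addr0 => [|w].
  apply: eq_bigr => w /andP[/subsetP wE wD].
  rewrite (bigID (mem w)) /=; congr (_ * _).
    rewrite (eq_bigr (fun=> p)) ?prodr_const // => i iw.
    by rewrite iw /F inE wE // (disjointFr wD iw).
  rewrite (bigID (mem E)) /= [X in _ = _ * X]big1 ?mulr1 => [|i /andP[/negbTE iw /negbTE iE]].
    rewrite (eq_bigr (fun=> 1 - p)) ?prodr_const => [|i /andP[/negbTE -> iE]].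
      by congr (_ ^+ _); apply: eq_card => i; rewrite !inE.
    by rewrite /G iE.
  by rewrite iw /G iE.
rewrite negb_and => H.
have [i iw iED] : exists2 i, i \in w & i \notin E :\: D.
  case/orP: H => [/subsetPn[i iw iE]|/pred0Pn[i /= /andP[iw iD]]].
    by exists i => //; rewrite inE negb_and iE orbT.
  by exists i => //; rewrite inE iD.
by rewrite (bigD1 i) //= iw /F (negbTE iED) mul0r.
Qed.

Section PercProb.
Variables (V : finType) (e : rel V) (R : realType) (p : R).
Hypothesis p01 : 0 <= p <= 1.

Lemma perc_weight_ge0 (w : {set {set V}}) :
  0 <= p ^+ #|w| * (1 - p) ^+ #|edges e :\: w|.
Proof. by case/andP: p01 => p0 p1; rewrite mulr_ge0 ?exprn_ge0 ?subr_ge0. Qed.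

Lemma perc_prob_total : perc_prob e p predT = 1.
Proof.
have := perc_prob_closed p (sub0set (edges e)); rewrite cards0 expr0 => <-.
by apply: eq_bigl => w; rewrite (disjointWr (sub0set (~: w))) // -setI_eq0 setICr.
Qed.

Lemma perc_probC (ev : pred {set {set V}}) :
  perc_prob e p ev = 1 - perc_prob e p (predC ev).
Proof.
apply/eqP; rewrite eq_sym subr_eq -perc_prob_total /perc_prob.
rewrite (bigID ev) /=; apply/eqP; congr (_ + _); apply: eq_bigl => w.
  by rewrite andbT.
by rewrite andbT.
Qed.

Lemma perc_prob_union (I : finType) (P : pred I) (F : I -> pred {set {set V}})
    (ev : pred {set {set V}}) :
  (forall w : {set {set V}}, w \subset edges e -> ev w -> exists2 i, P i & F i w) ->
  perc_prob e p ev <= \sum_(i | P i) perc_prob e p (F i).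
Proof.
move=> H; rewrite /perc_prob.
rewrite (exchange_big_dep (fun w : {set {set V}} => w \subset edges e)) /=; last first.
  by move=> i w _ /andP[].
rewrite [X in _ <= X](bigID ev) /= -[X in X <= _]addr0 lerD //; last first.
  by apply: sumr_ge0 => w _; apply: sumr_ge0 => i _; apply: perc_weight_ge0.
apply: ler_sum => w /andP[wE /(H w wE)[i Pi Fi]].
rewrite (bigD1 i) /=; last by rewrite Pi wE.
by rewrite lerDl; apply: sumr_ge0 => j _; apply: perc_weight_ge0.
Qed.

End PercProb.

(** * Closed cuts separating two sets that are not joined *)

Lemma edge_boundary_gt0 (V : finType) (e : rel V) (S : {set V}) :
  symmetric e -> connected_graph e -> S != set0 -> S != setT ->
  (0 < edge_boundary e S)%N.
Proof.
move=> esym con /set0Pn[x xS] /eqP ST; rewrite lt0n; apply/negP.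
rewrite cards_eq0 => /eqP/setP b0; apply: ST; apply/setP => y; rewrite [RHS]inE.
have cl : closed e (mem S).
  apply: intro_closed => [|u v euv uS]; first exact: sym_connect_sym.
  by have := b0 (u, v); rewrite !inE /= uS euv andbT => /negbFE.
by have /= <- := closed_connect cl (con x y).
Qed.

(* The closed cut of least size works: were [S] a union of components of the
   graph cut along [K], swapping sides on [S] would leave a smaller cut. *)
Lemma exists_admissible (V : finType) (e : rel V) (A B : {set V})
    (w : {set {set V}}) : symmetric e -> connected_graph e -> A != set0 ->
  ~~ joined e w A B ->
  exists2 K, admissible e A B K & [disjoint w & cut_edges e K].
Proof.
move=> esym con A0 NAB.
pose good (K : {set V}) := [&& A \subset K, [disjoint B & K] &
  [forall x, forall y, crosses e K x y ==> ([set x; y] \notin w)]].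
(* The union of the clusters of [A] is one closed cut, so a smallest one exists. *)
pose K0 := [set y | [exists a in A, connect (open_rel e w) a y]].
have good0 : good K0.
  apply/and3P; split.
  - by apply/subsetP => a aA; rewrite inE; apply/existsP; exists a; rewrite aA /=.
  - apply/pred0P => b /=; apply/negP => /andP[bB]; rewrite inE => /existsP[a /andP[aA ab]].
    move/negP: NAB; apply; apply/existsP; exists a; rewrite aA /=.
    by apply/existsP; exists b; rewrite bB.
  - apply/forallP => x; apply/forallP => y; apply/implyP => /andP[exy]; apply: contraNN => xyw.
    have oxy : open_rel e w x y by rewrite /open_rel exy.
    have oyx : open_rel e w y x by rewrite /open_rel esym exy setUC.
    rewrite !inE; apply/eqP; apply/idP/idP => /existsP[a /andP[aA ca]]; apply/existsP; exists a;
      by rewrite aA /=; apply: connect_trans ca (connect1 _).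
have [K /and3P[AK BK /forallP Kw] Kmin] := arg_minnP (fun K => edge_boundary e K) good0.
have cut x y : crosses e K x y -> [set x; y] \notin w.
  by move=> xy; have /forallP/(_ y)/implyP/(_ xy) := Kw x.
exists K; last first.
  rewrite disjoint_sym; apply/pred0P => i /=; apply/negP => /andP[/imsetP[[x y]]].
  rewrite inE /= => /and3P[xK yK exy] -> xyw.
  have /cut : crosses e K x y by rewrite /crosses exy xK (negbTE yK).
  by rewrite xyw.
apply/and3P; split=> //; apply/forallP => S; apply/implyP => /and3P[S0 dS homS].
apply: contraT => /existsPn Sout.
pose K' := [set x | (x \in K) (+) (x \in S)].
have outS x y : x \in S -> y \notin S -> e x y -> (x \in K) != (y \in K).
  move=> xS yS exy; have := Sout (x, y); rewrite !inE /= xS yS exy /= negbK.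
  by case/andP.
have inS x y : x \in S -> y \in S -> (x \in K) = (y \in K).
  move=> xS yS; case/orP: homS => [/subsetP SK|dSK]; first by rewrite !SK.
  by rewrite !(disjointFr dSK).
(* By [outS] all edges leaving [S] cross [K]; swapping sides on [S] uncrosses them and changes no
   other edge. *)
have crossK' x y : crosses e K' x y -> crosses e K x y && ((x \in S) == (y \in S)).
  rewrite /crosses !inE => /andP[exy]; rewrite exy /=.
  have [xS|xS] := boolP (x \in S); have [yS|yS] := boolP (y \in S) => //=.
  - by rewrite !addbT (inj_eq negb_inj) => ->.
  - by have := outS _ _ xS yS exy; case: (x \in K); case: (y \in K).
  - have eyx : e y x by rewrite esym.
    by have := outS _ _ yS xS eyx; case: (x \in K); case: (y \in K).
  - by rewrite !addbF => ->.
have good' : good K'.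
  apply/and3P; split.
  - apply/subsetP => a aA; rewrite inE (subsetP AK) //=.
    by rewrite (disjointFl dS) // inE aA.
  - apply/pred0P => b /=; apply/negP => /andP[bB]; rewrite inE (disjointFr BK) //=.
    by rewrite (disjointFl dS) // inE bB orbT.
  - apply/forallP => x; apply/forallP => y; apply/implyP => /crossK' /andP[xy _].
    exact: cut.
have ST : S != setT.
  case/set0Pn: A0 => a aA; apply: contraTneq dS => ->.
  by apply/pred0Pn; exists a; rewrite /= !inE aA.
(* Connectedness provides such an edge, so [K'] is strictly smaller than the minimal cut [K]. *)
have /card_gt0P[[s t]] := edge_boundary_gt0 esym con S0 ST.
rewrite inE /= => /and3P[sS tS est].
have := Kmin _ good'; rewrite leqNgt => /negP[].
rewrite -(ltn_pmul2l (isT : 0 < 2)%N) -!(sum_crossing_degreeE _ esym).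
rewrite /crossing_degree; apply: leq_ltn_trans (_ : _ <= _)%N _.
  apply: leq_sum => x _; apply: (subset_leq_card
    (B := [set y | crosses e K x y && ((x \in S) == (y \in S))])).
  by apply/subsetP => y; rewrite !inE -/(crosses e K' x y) => /crossK'.
rewrite [ltnLHS](bigD1 s) //= [ltnRHS](bigD1 s) //= -addSn leq_add //.
  apply: proper_card; apply/properP; split.
    by apply/subsetP => y; rewrite !inE => /andP[].
  exists t; rewrite !inE ?sS ?(negbTE tS) ?andbF //.
  by rewrite /crosses est outS.
apply: leq_sum => x _; apply: subset_leq_card.
by apply/subsetP => y; rewrite !inE => /andP[].
Qed.

(** * Elementary exponential bounds *)

Lemma expR_le_inv1D (R : realType) (t : R) : 0 <= t -> expR (- t) <= (1 + t)^-1.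
Proof.
move=> t0; rewrite expRN lef_pV2 ?posrE ?expR_gt0 ?expR_ge1Dx //.
by rewrite ltr_pwDl.
Qed.

(** An exponent of order [n / b] would fail at [n = b - 1], where the right side is [1 / b]; the
    square root leaves room. For [2 n <= b] use [exp (- 2 y) <= 1 - y] with [y = n / b]; otherwise
    the exponent is at least [2 sqrt b], and [exp (- 2 sqrt b) <= 1 / b]. *)
Lemma expR_le_1B_ratio (R : realType) (n b : nat) : (n < b)%N ->
  expR (- (4 * n%:R / Num.sqrt b%:R)) <= 1 - n%:R / b%:R :> R.
Proof.
move=> nb; set s : R := Num.sqrt b%:R.
have b1 : 1 <= b%:R :> R by rewrite ler1n; lia.
have s1 : 1 <= s by rewrite -sqrtr1 ler_wsqrtr.
have ss : s ^+ 2 = b%:R by rewrite sqr_sqrtr //; lra.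
have nb1 : n%:R + 1 <= b%:R :> R by rewrite natr1 ler_nat.
have n0 : 0 <= n%:R :> R by [].
have s0 : 0 < s by lra.
have b0 : 0 < b%:R :> R by lra.
have [small|large] := lerP (2 * n%:R) (b%:R : R).
  set y : R := n%:R / b%:R.
  have y0 : 0 <= y by rewrite divr_ge0.
  have y2 : 2 * y <= 1 by rewrite mulrA ler_pdivrMr // mul1r.
  apply: (@le_trans _ _ (expR (- (2 * y)))).
    rewrite ler_expR lerN2 /y -ss mulrA ler_pdivrMr ?exprn_gt0 //.
    rewrite mulrAC ler_pdivlMr // expr2 mulrA -!mulrA.
    have : 0 <= n%:R * (s * (2 * s - 1)) by rewrite !mulr_ge0 //; lra.
    by nra.
  apply: le_trans (expR_le_inv1D _) _; first by lra.
  by rewrite -[X in X <= _]mul1r ler_pdivrMr; nra.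
apply: (@le_trans _ _ (expR (- (s + s)))).
  rewrite ler_expR lerN2 ler_pdivlMr //; move: ss; rewrite expr2 => ss; lra.
apply: (@le_trans _ _ b%:R^-1).
  rewrite expRN lef_pV2 ?posrE ?expR_gt0 // expRD -ss expr2.
  by have e1 := expR_ge1Dx s; apply: ler_pM => //; lra.
by rewrite -(ler_pM2r b0) mulVf ?gt_eqF // mulrBl mulfVK ?gt_eqF //; lra.
Qed.

(** * Cut sums and disconnection probabilities under isoperimetry *)

Section CutSum.
Variables (R : realType) (a c : R).
Hypotheses (a_gt0 : 0 < a) (c_gt0 : 0 < c).

(** Sum of the geometric series of charges [4 / sqrt (c s^a)] over the sizes [s = 1, 2, 4, ...];
    [size_weight s] is the same series started at [s]. *)
Definition cut_rate : R := 4 / (Num.sqrt c * (1 - 2 `^ (- (a / 2)))).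

Definition size_weight (s : nat) : R := cut_rate * s%:R `^ (- (a / 2)).

Lemma powR2_lt1 : 2 `^ (- (a / 2)) < 1 :> R.
Proof.
have a2 : 0 < a / 2 by rewrite divr_gt0.
have := @gt0_ltr_powR R (a / 2) a2 1 2; rewrite !nnegrE ler01 ler0n ltr1n powR1.
by rewrite powRN invf_lt1 ?powR_gt0 //; apply.
Qed.

Lemma cut_rate_gt0 : 0 < cut_rate.
Proof.
by rewrite divr_gt0 // mulr_gt0 ?sqrtr_gt0 // subr_gt0 powR2_lt1.
Qed.

Lemma sum_expR_cut (V : finType) (e : rel V) (A B : {set V}) :
  symmetric e ->
  (forall K : {set V},
    c * (minn #|K| #|~: K|)%:R `^ a <= (edge_boundary e K)%:R) ->
  \sum_(K | admissible e A B K)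
    expR (- (2 * cut_rate * (edge_boundary e K)%:R)) <= 2.
Proof.
move=> esym iso.
have := @sum_expR_crossing_degree V e A B R size_weight.
have -> : size_weight 1 = cut_rate by rewrite /size_weight powR1 mulr1.
have rate0 := cut_rate_gt0.
move=> H; apply: le_trans (H _ _ _) => [|s|s t|S n S0 szS nS].
- apply: ler_sum => K _; rewrite ler_expR lerN2 sum_crossing_degreeE //.
  by rewrite -[leLHS]mulr_natr natrM mulrA [cut_rate * _]mulrC.
- by rewrite mulr_ge0 ?powR_ge0 // ltW.
- case/andP=> s0 st; rewrite ler_pM2l // !powRN lef_pV2 ?posrE ?powR_gt0 ?ltr0n //.
    by apply: ge0_ler_powR; rewrite ?nnegrE ?ler_nat // ltW // divr_gt0.
  exact: leq_trans st.
apply: le_trans (expR_le_1B_ratio R nS); rewrite ler_expR lerN2.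
set s := #|S|; set b := edge_boundary e S.
have s0 : (0 < s)%N by rewrite card_gt0.
have b0 : 0 < b%:R :> R by rewrite ltr0n; apply: leq_ltn_trans nS.
have -> : size_weight s - size_weight (2 * s) = 4 / (Num.sqrt c * s%:R `^ (a / 2)).
  rewrite /size_weight natrM powRM // /cut_rate.
  rewrite [s%:R `^ (- _)]powRN.
  have := powR2_lt1; set q := 2 `^ _ => q1.
  have sa : s%:R `^ (a / 2) != 0 :> R by rewrite gt_eqF // powR_gt0 ?ltr0n.
  have c0 : Num.sqrt c != 0 by rewrite gt_eqF // sqrtr_gt0.
  have q0 : 1 - q != 0 by rewrite gt_eqF // subr_gt0.
  by field; rewrite q0 c0 sa.
(* Isoperimetry for [S], which has at most half of the vertices. *)
have sb : Num.sqrt c * s%:R `^ (a / 2) <= Num.sqrt b%:R.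
  rewrite powRrM powR12_sqrt ?powR_ge0 // -sqrtrM; last exact: ltW.
  apply: ler_wsqrtr; apply: le_trans (iso S).
  rewrite (minn_idPl _) //.
  have := cardsC S; rewrite -/s; move: szS; rewrite -/s; lia.
rewrite -[leRHS]mulr_natr [leRHS]mulrAC ler_wpM2l ?mulr_ge0 // lef_pV2 // posrE.
  by rewrite sqrtr_gt0.
by rewrite mulr_gt0 ?sqrtr_gt0 // powR_gt0 ?ltr0n.
Qed.

(** Union bound over closed admissible cuts. In the exponent [(2 * cut_rate + 1 + t) * b] the first
    term is absorbed by [sum_expR_cut], the second is at least [c * min^a] by isoperimetry since [K]
    contains [A] and misses [B], and the third is at least [t] because [b >= 1]. *)
Lemma perc_prob_not_joined (V : finType) (e : rel V) (A B : {set V}) (t p : R) :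
  symmetric e -> connected_graph e -> A != set0 -> B != set0 ->
  (forall K : {set V},
    c * (minn #|K| #|~: K|)%:R `^ a <= (edge_boundary e K)%:R) ->
  0 <= t -> 1 - expR (- (2 * cut_rate + 1 + t)) <= p -> p <= 1 ->
  perc_prob e p (fun w => ~~ joined e w A B) <=
    2 * expR (- t) * expR (- (c * (minn #|A| #|B|)%:R `^ a)).
Proof.
move=> esym con A0 B0 iso t0 pt p1.
have rate0 := cut_rate_gt0.
have L0 : 0 <= 2 * cut_rate + 1 + t by lra.
have p01 : 0 <= p <= 1.
  rewrite p1 andbT; apply: le_trans pt; rewrite subr_ge0 -[leRHS]expR0 ler_expR; lra.
apply: le_trans (@perc_prob_union _ e _ p p01 _ (admissible e A B)
  (fun K w => [disjoint w & cut_edges e K]) _ _) _.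
  by move=> w _; apply: exists_admissible.
apply: (@le_trans _ _ (\sum_(K | admissible e A B K)
   expR (- (2 * cut_rate * (edge_boundary e K)%:R)) *
   (expR (- t) * expR (- (c * (minn #|A| #|B|)%:R `^ a))))); last first.
  rewrite -mulr_suml -mulrA ler_wpM2r ?mulr_ge0 ?expR_ge0 //.
  exact: sum_expR_cut.
apply: ler_sum => K /and3P[AK BK _].
rewrite perc_prob_closed ?cut_edges_subset // card_cut_edges.
set b := edge_boundary e K.
have BKC : B \subset ~: K by rewrite -disjoints_subset.
have b1 : 1 <= b%:R :> R.
  rewrite ler1n; apply: edge_boundary_gt0 => //.
    by apply: contraNneq A0 => K0; rewrite -subset0 -K0.
  by apply: contraNneq B0 => KT; rewrite -subset0 -(setCT V) -KT.
have mb : c * (minn #|A| #|B|)%:R `^ a <= b%:R.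
  apply: le_trans (iso K); rewrite ler_pM2l //.
  apply: ge0_ler_powR; [exact: ltW|exact: ler0n|exact: ler0n|].
  rewrite ler_nat leq_min !geq_min.
  by rewrite (subset_leq_card AK) (subset_leq_card BKC) orbT.
apply: (@le_trans _ _ (expR (- (2 * cut_rate + 1 + t)) ^+ b)).
  by apply: lerXn2r; rewrite ?nnegrE ?expR_ge0 //; lra.
rewrite -expRM_natr -!expRD ler_expR.
have : 0 <= t * (b%:R - 1) by rewrite mulr_ge0 //; lra.
by move: mb; set M := c * _; nra.
Qed.

End CutSum.

(** * Markov's inequality, choice of constants and conclusion *)

Lemma perc_prob_markov (V : finType) (e : rel V) (R : realType) (p s : R)
    (X : {set {set V}} -> {set V}) : 0 <= p <= 1 ->
  perc_prob e p (fun w => s < #|X w|%:R) * s <=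
    \sum_u perc_prob e p (fun w => u \in X w).
Proof.
move=> p01; rewrite /perc_prob.
rewrite (exchange_big_dep (fun w : {set {set V}} => w \subset edges e)) /=; last first.
  by move=> u w _ /andP[].
rewrite [leRHS](bigID (fun w => s < #|X w|%:R)) /= -[leLHS]addr0 lerD //; last first.
  by apply: sumr_ge0 => w _; apply: sumr_ge0 => u _; apply: perc_weight_ge0.
rewrite mulr_suml; apply: ler_sum => w /andP[wE sw].
rewrite (eq_bigl (mem (X w))) => [|u]; last by rewrite wE.
by rewrite sumr_const -[leRHS]mulr_natr ler_wpM2l ?perc_weight_ge0 // ltW.
Qed.

Lemma joined_set1 (V : finType) (e : rel V) (w : {set {set V}}) (v u : V) :
  joined e w [set v] [set u] = (u \in cluster e w v).
Proof.
rewrite inE; apply/existsP/idP => [[x /andP[/set1P ->]]|vu].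
  by move=> /existsP[y /andP[/set1P ->]].
by exists v; rewrite set11; apply/existsP; exists u; rewrite set11.
Qed.

Theorem theorem1p5 (R : realType) (k : nat) (c d : R) :
  (1 <= k)%N -> 0 < c -> 6 + 2 * Num.sqrt 7 < d ->
  exists eta : R, 0 < eta /\
  forall eps : R, 0 < eps ->
  exists p0 : R, 0 < p0 < 1 /\
  forall (V : finType) (e : rel V),
    symmetric e -> irreflexive e ->
    connected_graph e -> max_degree_le e k -> isoperimetric e d c ->
    forall p : R, p0 <= p -> p <= 1 ->
      (forall v : V,
         perc_prob e p
           (fun w => (#|cluster e w v|)%:R >= (1 - eps) * #|V|%:R)
         >= 1 - eps)
      /\
      (forall A B : {set V}, A != set0 -> B != set0 ->
         perc_prob e p (fun w => joined e w A B)
         >= 1 - eps * expR (- eta * powR (minn #|A| #|B|)%:R ((d - 2) / d))).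
Proof.
move=> _ c0 d6.
have d1 : 1 < d by have := sqrtr_ge0 (7 : R); lra.
set a := (d - 1) / d.
have a0 : 0 < a by rewrite divr_gt0 //; lra.
exists c; split=> // eps eps0.
(* Makes [2 * expR (- t)] at most [eps], used for (ii), and at most [eps ^+ 2], used for (i). *)
set t := 2 / eps + 2 / eps ^+ 2.
have t1 : 0 <= 2 / eps by rewrite divr_ge0 // ltW.
have t2 : 0 <= 2 / eps ^+ 2 by rewrite divr_ge0 // exprn_ge0 // ltW.
have t0 : 0 <= t by rewrite addr_ge0.
have small x : 0 < x -> 2 / x <= t -> 2 * expR (- t) <= x.
  move=> x0 xt; apply: (@le_trans _ _ (2 * (1 + t)^-1)).
    by rewrite ler_pM2l // expR_le_inv1D.
  rewrite ler_pdivrMr; last by lra.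
  by move: xt; rewrite ler_pdivrMr // => xt; lra.
have small1 : 2 * expR (- t) <= eps by apply: small => //; rewrite lerDl.
have small2 : 2 * expR (- t) <= eps ^+ 2.
  by apply: small; rewrite ?exprn_gt0 // lerDr.
have rate0 := cut_rate_gt0 a0 c0.
exists (1 - expR (- (2 * cut_rate a c + 1 + t))); split.
  rewrite subr_gt0 gtrBl expR_gt0 andbT -[ltRHS]expR0 ltr_expR; lra.
move=> V e esym _ con _ iso p p0p p1.
have p01 : 0 <= p <= 1.
  rewrite p1 andbT; apply: le_trans p0p; rewrite subr_ge0 -[leRHS]expR0 ler_expR; lra.
have disc A B : A != set0 -> B != set0 -> perc_prob e p (fun w => ~~ joined e w A B) <=
    2 * expR (- t) * expR (- (c * (minn #|A| #|B|)%:R `^ a)).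
  by move=> A0 B0; apply: perc_prob_not_joined.
split=> [v|A B A0 B0]; rewrite perc_probC // lerD2l lerN2; last first.
  apply: le_trans (disc A B A0 B0) _.
  apply: ler_pM; rewrite ?mulr_ge0 ?expR_ge0 // ler_expR mulNr lerN2 ler_pM2l //.
  (* The minimum is at least 1, so the exponent [(d - 1) / d] may be lowered to [(d - 2) / d]. *)
  apply: ler_powR; first by rewrite ler1n leq_min !card_gt0 A0.
  by rewrite ler_pM2r ?invr_gt0; lra.
have V0 : 0 < #|V|%:R :> R by rewrite ltr0n; apply/card_gt0P; exists v.
(* Each vertex misses the cluster of [v] with probability at most [eps ^+ 2], so more than
   [eps * #|V|] vertices do with probability at most [eps]. *)
have := perc_prob_markov e (eps * #|V|%:R) (fun w => ~: cluster e w v) p01.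
have -> : perc_prob e p (fun w => eps * #|V|%:R < #|~: cluster e w v|%:R) =
    perc_prob e p (predC (fun w => (1 - eps) * #|V|%:R <= #|cluster e w v|%:R)).
  apply: eq_bigl => w; congr andb; rewrite /= -ltNge.
  by rewrite -(cardsC (cluster e w v)) natrD; apply/idP/idP; lra.
move=> mk; rewrite -(ler_pM2r (mulr_gt0 eps0 V0)); apply: le_trans mk _.
apply: (@le_trans _ _ (\sum_(u : V) eps ^+ 2)); last first.
  by rewrite sumr_const -[leLHS]mulr_natr expr2 mulrA.
apply: ler_sum => u _; apply: le_trans small2.
have -> : perc_prob e p (fun w => u \in ~: cluster e w v) =
    perc_prob e p (fun w => ~~ joined e w [set v] [set u]).
  by apply: eq_bigl => w; rewrite joined_set1 inE.
apply: le_trans (disc _ _ _ _) _; try by apply/set0Pn; eexists; apply: set11.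
rewrite -[leRHS]mulr1 ler_wpM2l ?mulr_ge0 ?expR_ge0 //.
by rewrite -[leRHS]expR0 ler_expR oppr_le0 mulr_ge0 ?powR_ge0 // ltW.
Qed.
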